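(* Let $f:\mathbb{R}^n_{>0}\to\mathbb{R}^n_{>0}$ be order-preserving and homogeneous, and let $J\subset[n]$ be a nonempty proper subset such that $r(f^J_0)<\lambda(f^{[n]\setminus J}_\infty)$. If $f^J_0$ has a nonempty and $d_H$-bounded set of eigenvectors in $\mathbb{R}^J_{>0}$, then $r(f^I_0)<\lambda(f^{[n]\setminus I}_\infty)$ for all nonempty $I\subseteq J$. If $f^{[n]\setminus J}_\infty$ has a nonempty and $d_H$-bounded set of eigenvectors in the part $(0,\infty]^{[n]\setminus J}$, then $r(f^I_0)<\lambda(f^{[n]\setminus I}_\infty)$ for all $I\supseteq J$ with $I\ne[n]$.
   Context: $[n]=\{1,\dots,n\}$; $x\le y$ is the entrywise order. Order-preserving: $x\le y\Rightarrow f(x)\le f(y)$; homogeneous: $f(tx)=tf(x)$ for $t>0$. Every order-preserving homogeneous $f:\mathbb{R}^n_{>0}\to\mathbb{R}^n_{>0}$ extends continuously to order-preserving homogeneous maps $\mathbb{R}^n_{\ge0}\to\mathbb{R}^n_{\ge0}$ and $(0,\infty]^n\to(0,\infty]^n$, again denoted $f$. For $\alpha\in[-\infty,\infty]$ and $J\subseteq[n]$, $P^J_\alpha(x)_j=x_j$ for $j\in J$ and $=\alpha$ otherwise; $f^J_0=P^J_0fP^J_0$ on $\mathbb{R}^n_{\ge0}$ and $f^J_\infty=P^J_\infty fP^J_\infty$ on $(0,\infty]^n$. For $g$ order-preserving homogeneous on $\mathbb{R}^n_{\ge0}$ or $(0,\infty]^n$: $r(g)=\inf_{x\in\mathbb{R}^n_{>0}}\max_i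 g(x)_i/x_i$, $\lambda(g)=\sup_{x\in\mathbb{R}^n_{>0}}\min_i g(x)_i/x_i$ (values in $[0,\infty]$). $\mathbb{R}^J_{>0}=\{x\in\mathbb{R}^n_{\ge0}:\{i:x_i>0\}=J\}$ and $(0,\infty]^{K}=\{x\in(0,\infty]^n:\{i:x_i<\infty\}=K\}$. An eigenvector of $g$ in one of these sets $S$ is $x\in S$ with $g(x)=\mu x$ for some $\mu$. Hilbert's projective metric between two vectors $x,y$ in the same such set, with $L$ the set of coordinates where they are positive and finite, is $d_H(x,y)=\log\max_{i,j\in L}\frac{y_ix_j}{x_iy_j}$; $d_H$-bounded means finite $d_H$-diameter. *)

(* Defs.v *)
From HB Require Import structures.
From mathcomp Require Import all_boot all_order all_algebra.
From mathcomp Require Import all_classical all_reals.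
From mathcomp Require Import ereal exp.
Set Implicit Arguments. Unset Strict Implicit. Unset Printing Implicit Defensive.
Import Order.TTheory GRing.Theory Num.Theory.
Local Open Scope ring_scope.
Local Open Scope classical_set_scope.

Section Defs.
Variables (R : realType) (n : nat).

(* vectors in [-oo,+oo]^n ; the relevant ones live in R^n_{>=0} or (0,oo]^n *)
Definition evec := 'I_n -> \bar R.

(* continuous extension of an order-preserving homogeneous f : R^n_{>0} -> R^n_{>0}
   to R^n_{>=0}:  f(x) = lim_{e -> 0+} f(x + e 1) = inf_{e>0} f(x + e 1) *)
Definition ext0 (f : ('I_n -> R) -> ('I_n -> R)) (x : evec) : evec :=
  fun i => ereal_inf [set ((f (fun j => fine (x j) + e)) i)%:E | e in [set e : R | 0 < e]].

(* continuous extension to (0,oo]^n:  f(x) = lim_{t -> oo} f(min(x, t 1)) = sup_t f(min(x,t 1)) *)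
Definition extinf (f : ('I_n -> R) -> ('I_n -> R)) (x : evec) : evec :=
  fun i => ereal_sup [set ((f (fun j => fine (mine (x j) t%:E))) i)%:E | t in [set t : R | 0 < t]].

Definition Pj (alpha : \bar R) (J : {set 'I_n}) (x : evec) : evec :=
  fun j => if j \in J then x j else alpha.

Definition f0 f J : evec -> evec := fun x => Pj 0%E J (ext0 f (Pj 0%E J x)).
Definition finf f J : evec -> evec := fun x => Pj +oo%E J (extinf f (Pj +oo%E J x)).

Definition posvec (x : 'I_n -> R) := forall i, 0 < x i.

Definition rspec (g : evec -> evec) : \bar R :=
  ereal_inf [set (\big[maxe/-oo%E]_i (g (fun j => (x j)%:E) i * ((x i)^-1)%:E))%E
            | x in [set x | posvec x]].
Definition lspec (g : evec -> evec) : \bar R :=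
  ereal_sup [set (\big[mine/+oo%E]_i (g (fun j => (x j)%:E) i * ((x i)^-1)%:E))%E
            | x in [set x | posvec x]].

Definition part0 (J : {set 'I_n}) (x : evec) :=
  forall i, (i \in J -> (0 < x i < +oo)%E) /\ (i \notin J -> x i = 0%E).
Definition partinf (K : {set 'I_n}) (x : evec) :=
  forall i, (i \in K -> (0 < x i < +oo)%E) /\ (i \notin K -> x i = +oo%E).

Definition eigvec_in (g : evec -> evec) (S : evec -> Prop) (x : evec) :=
  S x /\ exists mu : R, g x = (fun i => (mu%:E * x i)%E).

(* Hilbert's projective metric, L = coordinates where x (equivalently y) is positive and finite *)
Definition Lset (x : evec) := [pred i | (0 < x i < +oo)%E].
Definition dH (x y : evec) : R :=
  \big[Num.max/0]_(i | Lset x i) \big[Num.max/0]_(j | Lset x j)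
     ln ((fine (y i) * fine (x j)) / (fine (x i) * fine (y j))).

Definition dH_bounded (E : evec -> Prop) :=
  exists C : R, forall x y, E x -> E y -> dH x y <= C.

End Defs.

(* Main.v *)
(* Call [gap f I] the existence of positive x, y and 0 < a < b with f x <= a x
   on I and f y >= b y off I; this is r(f^I_0) < lambda(f^{[n]\I}_oo), and it is
   self-dual under f*(x) = 1 / f (1 / x), I -> ~I, so that the second half of
   the theorem is the first half for f*.

   For the first half, conjugate f^J_0 by its eigenvector into a map g with
   g 1 = 1, and suppose the gap fails at some proper I in J while it holds at J.
   Then there are no a < 1 with g x <= a x on I, and no b > 1 with g y >= b y on
   J \ I. For every M >= 1, the first fact gives V in [1, M]^n with V <= g V,
   V = 1 off I and V_i = M for some i in I; the second gives, by duality,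
   W >= V with g W <= W, W = M off J \ I and W_k = 1 for some k in J \ I.
   Tarski's theorem puts a fixed point of g between V and W, so the eigenvectors
   of f^J_0 are unbounded in Hilbert's metric. *)

Require Import Defs.
From HB Require Import structures.
From mathcomp Require Import all_boot all_order all_algebra.
From mathcomp Require Import all_classical all_reals.
From mathcomp Require Import ereal exp.
From mathcomp Require Import ring lra.
Import Order.TTheory GRing.Theory Num.Theory.
Local Open Scope ring_scope.

(** * Simultaneous witnesses and bounds for positive vectors *)

(** Induction over the finite index set, merging two witnesses at a time by directedness. It turns
    coordinatewise approximations into one approximation valid in all coordinates. *)
Lemma common_witness {I : finType} {T : Type} (D : T -> Prop)
    (le : T -> T -> Prop) (P : I -> T -> Prop) :
  (exists a, D a) ->
  (forall a b, D a -> D b -> exists c, [/\ D c, le c a & le c b]) ->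
  (forall i a b, D a -> D b -> le b a -> P i a -> P i b) ->
  (forall i, exists a, D a /\ P i a) ->
  exists a, D a /\ forall i, P i a.
Proof.
move=> D0 dir mono ex.
suff /(_ (enum I)) [a [Da Pa]] : forall s : seq I,
    exists a, D a /\ forall i, i \in s -> P i a.
  by exists a; split=> // i; apply: Pa; rewrite mem_enum.
elim=> [|i s [a [Da Pa]]]; first by have [a Da] := D0; exists a.
have [b [Db Pb]] := ex i.
have [c [Dc ca cb]] := dir _ _ Da Db.
exists c; split=> // j; rewrite inE => /predU1P[->|js].
  exact: mono Db Dc cb Pb.
exact: mono Da Dc ca (Pa _ js).
Qed.

Lemma pos_lower_bound {R : realType} {n} (x : 'I_n -> R) :
  posvec x -> exists m, 0 < m /\ forall i, m <= x i.
Proof.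
move=> x0; apply: (common_witness (fun m : R => 0 < m) (fun a b => a <= b)).
- by exists 1.
- move=> a b a0 b0; exists (Num.min a b).
  by rewrite lt_min a0 b0 !ge_min !lexx orbT.
- by move=> i a b _ _ ba; apply: le_trans.
- by move=> i; exists (x i); split.
Qed.

Lemma pos_upper_bound {R : realType} {n} (x : 'I_n -> R) :
  exists M, 0 < M /\ forall i, x i <= M.
Proof.
apply: (common_witness (fun m : R => 0 < m) (fun a b => b <= a)).
- by exists 1.
- move=> a b a0 b0; exists (Num.max a b).
  by rewrite lt_max a0 !le_max !lexx orbT.
- by move=> i a b _ _ ab xa; apply: le_trans ab.
- move=> i; exists (Num.max 1 (x i)).
  by rewrite lt_max ltr01 le_max lexx orbT.
Qed.

Lemma le_of_forall_gt1 {R : realType} (x y : R) :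
  (forall c, 1 < c -> x <= c * y) -> x <= y.
Proof.
move=> h; rewrite leNgt; apply/negP => yx.
have [y0|y0] := leP y 0.
  by have := h 2 (ltr1n _ _); lra.
(* This factor sends [y] to the midpoint of [x] and [y]. *)
have /h : 1 < (x + y) / (2 * y) by rewrite ltr_pdivlMr; lra.
have -> : (x + y) / (2 * y) * y = (x + y) / 2 by field; lra.
lra.
Qed.

(** * Order-preserving homogeneous maps and duality *)

Definition ophom {R : realType} {n} (f : ('I_n -> R) -> 'I_n -> R) :=
  [/\ forall x, posvec x -> posvec (f x),
      forall x y, posvec x -> posvec y -> (forall i, x i <= y i) ->
        forall i, f x i <= f y i
    & forall t x, 0 < t -> posvec x ->
        forall i, f (fun j => t * x j) i = t * f x i].

Definition dualf {R : realType} {n} (f : ('I_n -> R) -> 'I_n -> R) :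
    ('I_n -> R) -> 'I_n -> R :=
  fun x i => (f (fun j => (x j)^-1) i)^-1.

Lemma posvecV {R : realType} {n} (x : 'I_n -> R) :
  posvec x -> posvec (fun j => (x j)^-1).
Proof. by move=> x0 i; rewrite invr_gt0. Qed.

Lemma posvecZ {R : realType} {n} (t : R) (x : 'I_n -> R) :
  0 < t -> posvec x -> posvec (fun j => t * x j).
Proof. by move=> t0 x0 i; rewrite mulr_gt0. Qed.

Lemma posvecM {R : realType} {n} (u x : 'I_n -> R) :
  posvec u -> posvec x -> posvec (fun j => u j * x j).
Proof. by move=> u0 x0 i; rewrite mulr_gt0. Qed.

Lemma dualf_ophom {R : realType} {n} (f : ('I_n -> R) -> 'I_n -> R) :
  ophom f -> ophom (dualf f).
Proof.
move=> [fp fm fh]; split=> [x x0 i|x y x0 y0 xy i|t x t0 x0 i]; rewrite /dualf.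
- by rewrite invr_gt0; apply/fp/posvecV.
- rewrite lef_pV2 ?posrE; try by apply/fp/posvecV.
  apply: fm; try exact: posvecV.
  by move=> j; rewrite lef_pV2 // posrE.
- have -> : (fun j => (t * x j)^-1) = (fun j => t^-1 * (x j)^-1).
    by apply/funext => j; rewrite invfM.
  rewrite fh ?invr_gt0 //; last exact: posvecV.
  by rewrite invfM invrK.
Qed.

Lemma ophom_le_scale {R : realType} {n} (f : ('I_n -> R) -> 'I_n -> R) (t : R)
    (x y : 'I_n -> R) : ophom f -> 0 < t -> posvec x -> posvec y ->
  (forall i, x i <= t * y i) -> forall i, f x i <= t * f y i.
Proof.
move=> [fp fm fh] t0 x0 y0 xy i; rewrite -fh //.
by apply: fm => //; apply: posvecZ.
Qed.

(** * Fixed points of large spread *)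

(** The supremum [z] of the sub-fixed points in the box is sub-fixed, hence so is [T z], which
    forces equality. The maximality clause serves to compare the fixed points of different maps. *)
Lemma tarski {R : realType} {n} (lo hi : 'I_n -> R)
    (T : ('I_n -> R) -> 'I_n -> R) :
  let box x := forall i, lo i <= x i <= hi i in
  (forall i, lo i <= hi i) ->
  (forall x, box x -> box (T x)) ->
  (forall x y, box x -> box y -> (forall i, x i <= y i) ->
     forall i, T x i <= T y i) ->
  exists z, [/\ box z, forall i, T z i = z i
    & forall x, box x -> (forall i, x i <= T x i) -> forall i, x i <= z i].
Proof.
move=> box lohi Tbox Tmono.
pose S := [set x | box x /\ forall i, x i <= T x i]%classic.
pose z i := sup [set x i | x in S]%classic.
have boxlo : box lo by move=> i; rewrite lexx lohi.
have Slo : S lo by split=> // i; have /andP[] := Tbox _ boxlo i.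
have ub i : has_ubound [set x i | x in S]%classic.
  by exists (hi i) => _ [x [xb _] <-]; have /andP[] := xb i.
have ne i : ([set x i | x in S] !=set0)%classic by exists (lo i), lo.
have Sz x : S x -> forall i, x i <= z i.
  by move=> Sx i; apply: ub_le_sup => //; exists x.
have zb : box z.
  move=> i; rewrite (Sz _ Slo) /=; apply: ge_sup => // _ [x [xb _] <-].
  by have /andP[] := xb i.
have zT i : z i <= T z i.
  apply: ge_sup => // _ [x Sx <-]; have [xb xT] := Sx.
  by apply: le_trans (xT i) _; apply: Tmono => //; apply: Sz.
exists z; split=> [//|i|x xb xT i]; last by apply: Sz.
apply/le_anti; rewrite zT andbT; apply: Sz; split; first exact: Tbox.
by apply: Tmono => //; apply: Tbox.
Qed.

(* [V] is the limit, as [c] decreases to [1], of the greatest vectors in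
   [[1, M]^n] that equal [1] off [I] and [min (c * g x) M] on [I]; a limit
   staying below [M] on [I] would violate the first hypothesis on [g]. *)
Lemma large_subfixed {R : realType} {n} (g : ('I_n -> R) -> 'I_n -> R)
    (I : {set 'I_n}) (M : R) :
  ophom g -> (forall i, g (fun=> 1) i = 1) ->
  (forall a x, a < 1 -> posvec x -> ~ forall i, i \in I -> g x i <= a * x i) ->
  1 <= M ->
  exists V, [/\ forall i, 1 <= V i <= M, forall i, i \notin I -> V i = 1,
    exists2 i, i \in I & V i = M & forall i, V i <= g V i].
Proof.
move=> gP g1 nogap M1; have [gp gm gh] := gP.
pose box x := forall i : 'I_n, 1 <= x i <= M.
have bp x : box x -> posvec x.
  by move=> xb i; have /andP[x1 _] := xb i; apply: lt_le_trans x1.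
have pos1 : posvec (fun=> 1 : R) (n := n) by move=> i.
have g_ge1 x : box x -> forall i, 1 <= g x i.
  move=> xb i; rewrite -{1}(g1 i); apply: gm => //; first exact: bp.
  by move=> j; have /andP[] := xb j.
pose T c x i := if i \in I then Num.min (c * g x i) M else 1.
(* The guard [1 < c] sits under the existential so that [choice] gives a function on all reals;
   other values of [c] get a default vector. *)
have exZ c : exists z, 1 < c -> [/\ box z, forall i, T c z i = z i
    & forall x, box x -> (forall i, x i <= T c x i) -> forall i, x i <= z i].
  have [c1|] := boolP (1 < c); last by exists (fun=> 1).
  have [//|x xb i|x y xb yb xy i|z zP] :=
    @tarski _ n (fun=> 1) (fun=> M) (T c).
  - rewrite /T; case: ifP => _; last by rewrite lexx M1.
    rewrite le_min M1 ge_min lexx orbT !andbT.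
    by have := g_ge1 x xb i; nra.
  - rewrite /T; case: ifP => // _.
    rewrite le_min !ge_min lexx orbT andbT.
    rewrite ler_pM2l ?(lt_trans _ c1) // gm //; exact: bp.
  - by exists z.
have [Z ZP] := choice exZ.
have Zbox c : 1 < c -> box (Z c) by move=> /ZP[].
have Zfix c : 1 < c -> forall i, T c (Z c) i = Z c i by move=> /ZP[].
have Zoff c i : 1 < c -> i \notin I -> Z c i = 1.
  by move=> c1 iI; rewrite -Zfix // /T (negbTE iI).
have Zmono c d : 1 < c -> c <= d -> forall i, Z c i <= Z d i.
  move=> c1 cd; have d1 := lt_le_trans c1 cd.
  have [_ _ mx] := ZP d d1; apply: mx; first exact: Zbox.
  move=> i; rewrite -{1}(Zfix c c1) /T; case: ifP => // _.
  rewrite le_min !ge_min lexx orbT andbT.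
  by rewrite ler_wpM2r // (le_trans ler01) // g_ge1 //; apply: Zbox.
have dir (a b : R) : 1 < a -> 1 < b -> exists c, [/\ 1 < c, c <= a & c <= b].
  move=> a1 b1; exists (Num.min a b).
  by rewrite lt_min a1 b1 !ge_min !lexx orbT.
have gt1 : exists c : R, 1 < c by exists 2; rewrite ltr1n.
(* Otherwise each [i] in [I] has some [c] with [Z c i < M]; by monotonicity one [c] serves all of
   [I], where then [c * g (Z c) = Z c], against [nogap] for [c^-1]. *)
have [i0 i0I ZM] : exists2 i, i \in I & forall c, 1 < c -> Z c i = M.
  apply: contrapT => no.
  have [//|//|i a b a1 b1 ba Za iI|i|c [c1 Zc]] := common_witness (I := 'I_n)
    (fun c : R => 1 < c) (fun b a => b <= a)
    (fun i c => i \in I -> Z c i < M).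
  - by apply: le_lt_trans (Za iI); apply: Zmono.
  - apply: contrapT => noi; apply: no.
    have iI : i \in I.
      apply: contrapT => iI; apply: noi; exists 2.
      by rewrite ltr1n; split.
    exists i => // c c1; apply: contrapT => Zc; apply: noi; exists c; split=> // _.
    by rewrite lt_neqAle; have /andP[_ ->] := Zbox _ c1 i; rewrite andbT; apply/eqP.
  - have c0 : 0 < c by lra.
    apply: (nogap c^-1 (Z c)); first by rewrite invf_lt1.
      exact/bp/Zbox.
    move=> i iI; have := Zfix c c1 i; have := Zc i iI; rewrite /T iI.
    by rewrite ler_pdivlMl //; case: (leP (c * _) M) => _ + h; rewrite h ?ltxx.
pose V i := inf [set Z c i | c in [set c | 1 < c]]%classic.
have Zlb i : has_lbound [set Z c i | c in [set c | 1 < c]]%classic.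
  by exists 1 => _ [c c1 <-]; have /andP[] := Zbox c c1 i.
have Zne i : ([set Z c i | c in [set c | 1 < c]] !=set0)%classic.
  by have [c c1] := gt1; exists (Z c i), c.
have VZ c : 1 < c -> forall i, V i <= Z c i.
  by move=> c1 i; apply: ge_inf => //; exists c.
have Vbox : box V.
  move=> i; apply/andP; split.
    by apply: lb_le_inf => // _ [c c1 <-]; have /andP[] := Zbox c c1 i.
  have [c c1] := gt1; apply: le_trans (VZ c c1 i) _.
  by have /andP[] := Zbox c c1 i.
have Voff i : i \notin I -> V i = 1.
  move=> iI; apply/le_anti; have /andP[-> _] := Vbox i; rewrite andbT.
  by have [c c1] := gt1; rewrite -(Zoff c i) // VZ.
exists V; split=> //.
  exists i0 => //; apply/le_anti; have /andP[_ ->] := Vbox i0 => /=.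
  by apply: lb_le_inf => // _ [c c1 <-]; rewrite ZM.
move=> i; have [iI|iI] := boolP (i \in I); last by rewrite Voff // g_ge1.
(* Two slack factors replace continuity of [g]: [e] bounds [Z k] by [e * V], hence [g (Z k)] by
   [e * g V], and [d] bounds the factor [k] in [T k]. *)
apply: le_of_forall_gt1 => d d1; apply: le_of_forall_gt1 => e e1.
have [//|//|j a b a1 b1 ba|j|c [c1 Zc]] := common_witness (I := 'I_n)
    (fun c : R => 1 < c) (fun b a => b <= a) (fun i c => Z c i <= e * V i).
- by apply: le_trans; apply: Zmono.
- have /(inf_lt (Zne j)) [_ [c c1 <-] Zc] : V j < e * V j.
    by rewrite ltr_pMl //; apply: bp.
  by exists c; split=> //; apply: ltW.
have [k [k1 kc kd]] := dir _ _ c1 d1.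
apply: le_trans (VZ k k1 i) _.
have := Zfix k k1 i; rewrite /T iI => <-.
rewrite ge_min; apply/orP; left.
have gZ : g (Z k) i <= e * g V i.
  apply: ophom_le_scale => //; [lra|exact/bp/Zbox|exact: bp|].
  by move=> j; apply: le_trans (Zc j); apply: Zmono.
have gV0 : 0 < g V i by apply/gp/bp.
have gZ0 : 0 < g (Z k) i by apply/gp/bp/Zbox.
rewrite mulrCA; apply: ler_pM => //; lra.
Qed.

(** A sub-fixed vector [V] for [g] and the inverted, rescaled sub-fixed vector of the dual of [g]
    bound a box that [g] preserves. At [i] both bounds equal [M], and at [k] the upper one is
    [1]. *)
Lemma spread_fixed_point {R : realType} {n} (g : ('I_n -> R) -> 'I_n -> R)
    (I K : {set 'I_n}) (M : R) :
  ophom g -> (forall i, g (fun=> 1) i = 1) -> [disjoint I & K] ->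
  (forall a x, a < 1 -> posvec x -> ~ forall i, i \in I -> g x i <= a * x i) ->
  (forall b y, 1 < b -> posvec y -> ~ forall i, i \in K -> b * y i <= g y i) ->
  1 <= M ->
  exists z, [/\ posvec z, forall i, g z i = z i
    & exists i k, [/\ i \in I, k \in K, z i = M & z k <= 1]].
Proof.
move=> gP g1 IK noI noK M1; have [gp gm gh] := gP.
have [V [Vb Voff [i iI Vi] VgV]] := large_subfixed g I M gP g1 noI M1.
have [j|a x a1 x0 gx|//|V' [V'b V'off [k kK V'k] V'gV']] :=
    large_subfixed (dualf g) K M (dualf_ophom _ gP).
- rewrite /dualf; have -> : (fun=> 1^-1 : R) = (fun=> 1) :> ('I_n -> R).
    by apply/funext => l; rewrite invr1.
  by rewrite g1 invr1.
- have := x0; have := gp _ (posvecV _ x0); rewrite /posvec => gx0 xp.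
  (* Positivity of [a] follows from any coordinate in [K], and [K] is nonempty because [noK] is
     contradictory for an empty set. *)
  have a0 : 0 < a.
    have [k kK] : exists k, k \in K.
      apply: contrapT => K0; apply: (noK 2 (fun=> 1)) => //; first by rewrite ltr1n.
      by move=> k kK; case: K0; exists k.
    have := gx k kK; rewrite /dualf => h.
    rewrite -(pmulr_lgt0 _ (xp k)); apply: lt_le_trans h.
    by rewrite invr_gt0.
  apply: (noK a^-1 (fun j => (x j)^-1)); first by rewrite invf_gt1.
    exact: posvecV.
  move=> k kK; have := gx k kK; rewrite /dualf -invfM => h.
  by rewrite -lef_pV2 ?posrE ?invr_gt0 ?mulr_gt0 // invrK.
have V'0 : posvec V' by move=> j; have /andP[h _] := V'b j; apply: lt_le_trans h.
have V0 : posvec V by move=> j; have /andP[h _] := Vb j; apply: lt_le_trans h.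
have M0 : 0 < M by apply: lt_le_trans M1.
pose W j := M * (V' j)^-1.
have W0 : posvec W by apply: posvecZ => //; apply: posvecV.
have gW j : g W j <= W j.
  rewrite /W gh //; last exact: posvecV.
  rewrite ler_pM2l // -lef_pV2 ?posrE ?invr_gt0 //; last exact/gp/posvecV.
  by rewrite invrK.
(* On [I], disjoint from [K], [W] has its top value [M]; off [I], [V] has its bottom value [1]. *)
have VW j : V j <= W j.
  have [jI|jI] := boolP (j \in I).
    rewrite /W V'off; last by rewrite (disjointFr IK jI).
    by rewrite invr1 mulr1; have /andP[] := Vb j.
  rewrite Voff // /W ler_pdivlMr // mul1r.
  by have /andP[] := V'b j.
have bp x : (forall j, V j <= x j <= W j) -> posvec x.
  by move=> xb j; have /andP[h _] := xb j; apply: lt_le_trans h.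
have [//|x xb j|x y xb yb xy j|z [zb gz _]] := @tarski _ n V W g.
- apply/andP; split.
    apply: le_trans (VgV j) _; apply: gm => //; first exact: bp.
    by move=> l; have /andP[] := xb l.
  apply: le_trans (gW j); apply: gm => //; first exact: bp.
  by move=> l; have /andP[] := xb l.
- by apply: gm => //; apply: bp.
exists z; split=> //; first exact: bp.
exists i, k; split=> //.
  apply/le_anti; have := zb i; rewrite Vi andbC => /andP[zW -> /=].
  rewrite andbT; apply: le_trans zW _; rewrite /W V'off ?invr1 ?mulr1 //.
  by rewrite (disjointFr IK iI).
have /andP[_] := zb k; rewrite /W V'k mulfV //; exact: lt0r_neq0.
Qed.

(** * The gap condition: duality and gluing *)

Definition gap {R : realType} {n} (f : ('I_n -> R) -> 'I_n -> R)
    (I : {set 'I_n}) :=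
  exists a b x y, [/\ 0 < a < b, posvec x /\ posvec y,
    forall i, i \in I -> f x i <= a * x i
  & forall i, i \notin I -> b * y i <= f y i].

Lemma gap_dualf {R : realType} {n} (f : ('I_n -> R) -> 'I_n -> R)
    (I : {set 'I_n}) :
  ophom f -> gap f I -> gap (dualf f) (~: I).
Proof.
move=> [fp _ _] [a [b [x [y [/andP[a0 ab] [x0 y0] fx fy]]]]].
have b0 : 0 < b by apply: lt_trans ab.
exists b^-1, a^-1, (fun j => (y j)^-1), (fun j => (x j)^-1).
split; first by rewrite invr_gt0 b0 ltf_pV2.
- by split; apply: posvecV.
- move=> i; rewrite inE => /fy; rewrite /dualf -invfM.
  have -> : (fun j => (y j)^-1^-1) = y by apply/funext => j; rewrite invrK.
  by rewrite lef_pV2 ?posrE ?mulr_gt0 //; apply: fp.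
- move=> i; rewrite inE negbK => /fx; rewrite /dualf -invfM.
  have -> : (fun j => (x j)^-1^-1) = x by apply/funext => j; rewrite invrK.
  by rewrite lef_pV2 ?posrE ?mulr_gt0 //; apply: fp.
Qed.

Lemma dualfK {R : realType} {n} (f : ('I_n -> R) -> 'I_n -> R) :
  dualf (dualf f) = f.
Proof.
apply/funext => x; apply/funext => i; rewrite /dualf invrK; congr (f _ i).
by apply/funext => j; rewrite invrK.
Qed.

(** The lower vector for [I] is glued from a large multiple of [y] on [J] and the old lower vector
    [y'] off [J]. It dominates [y'], so the bound off [J] survives, while on [J] minus [I] the bound
    for [y] applies after rescaling. *)
Lemma gap_extend {R : realType} {n} (f : ('I_n -> R) -> 'I_n -> R)
    (I J : {set 'I_n}) (a b : R) (x y : 'I_n -> R) :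
  ophom f -> gap f J -> I \subset J -> 0 < a -> a < b -> posvec x -> posvec y ->
  (forall i, i \in I -> f x i <= a * x i) ->
  (forall z, posvec z -> (forall j, j \in J -> y j <= z j) ->
     forall j, j \in J -> j \notin I -> b * y j <= f z j) ->
  gap f I.
Proof.
move=> [fp fm fh] [a' [b' [x' [y' [/andP[a'0 ab'] [x'0 y'0] fx' fy']]]]] IJ.
move=> a0 ab x0 y0 fx fy.
have [m [m0 my]] := pos_lower_bound y y0.
have [M [M0 My']] := pos_upper_bound y'.
pose t := M / m.
have t0 : 0 < t by rewrite divr_gt0.
pose w j := if j \in J then t * y j else y' j.
have w0 : posvec w by move=> j; rewrite /w; case: ifP => // _; rewrite mulr_gt0.
have y'w j : y' j <= w j.
  rewrite /w; case: ifP => // _; apply: le_trans (My' j) _.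
  by rewrite /t mulrAC ler_pdivlMr // ler_pM2l.
have fw c : c <= b -> c <= b' -> forall i, i \notin I -> c * w i <= f w i.
  move=> cb cb' i iI; have [iJ|iJ] := boolP (i \in J).
    have : b * y i <= f (fun j => t^-1 * w j) i.
      apply: fy => //; first by apply: posvecZ => //; rewrite invr_gt0.
      by move=> j jJ; rewrite /w jJ mulKf // lt0r_neq0.
    rewrite fh ?invr_gt0 // ler_pdivlMl // => /(le_trans _); apply.
    by rewrite /w iJ mulrCA ler_pM2l // ler_pM2r.
  apply: le_trans (fm _ _ y'0 w0 y'w i); apply: le_trans (fy' i iJ).
  by rewrite /w (negbTE iJ) ler_pM2r.
(* The smaller of the two upper rates is kept, with its vector: it lies below both [b] and [b']. *)
have [aa'|aa'] := leP a' a.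
  exists a', (Num.min b b'), x', w; split=> //.
  - by rewrite a'0 lt_min ab' (le_lt_trans aa').
  - by move=> i /(fintype.subsetP IJ); apply: fx'.
  - by apply: fw; rewrite ge_min lexx ?orbT.
exists a, (Num.min b b'), x, w; split=> //.
- by rewrite a0 lt_min ab (lt_trans aa').
- by apply: fw; rewrite ge_min lexx ?orbT.
Qed.

(** * The boundary extension as an infimum *)

(* The continuous extension of [f] to the vectors vanishing off [J], read off
   from the vectors dominating [z] on [J]; only [z] on [J] matters. *)
Definition lowmap {R : realType} {n} (f : ('I_n -> R) -> 'I_n -> R)
    (J : {set 'I_n}) (z : 'I_n -> R) (j : 'I_n) : R :=
  inf [set f y j | y in
    [set y | posvec y /\ forall k, k \in J -> z k <= y k]]%classic.

Lemma lowmap_le {R : realType} {n} (f : ('I_n -> R) -> 'I_n -> R)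
    (J : {set 'I_n}) (z y : 'I_n -> R) j :
  ophom f -> posvec y -> (forall k, k \in J -> z k <= y k) ->
  lowmap f J z j <= f y j.
Proof.
move=> [fp _ _] y0 zy; apply: ge_inf; last by exists y.
by exists 0 => _ [w [w0 _] <-]; apply/ltW/fp.
Qed.

Lemma lowmap_ge {R : realType} {n} (f : ('I_n -> R) -> 'I_n -> R)
    (J : {set 'I_n}) (z : 'I_n -> R) (l : R) j :
  posvec z ->
  (forall y, posvec y -> (forall k, k \in J -> z k <= y k) -> l <= f y j) ->
  l <= lowmap f J z j.
Proof.
move=> z0 lf; apply: lb_le_inf; first by exists (f z j), z.
by move=> _ [w [w0 zw] <-]; apply: lf.
Qed.

Lemma lowmap_mono {R : realType} {n} (f : ('I_n -> R) -> 'I_n -> R)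
    (J : {set 'I_n}) (z w : 'I_n -> R) j :
  ophom f -> posvec w -> (forall k, k \in J -> z k <= w k) ->
  lowmap f J z j <= lowmap f J w j.
Proof.
move=> fP w0 zw; apply: lowmap_ge => // y y0 wy; apply: lowmap_le => // k kJ.
exact: le_trans (zw k kJ) (wy k kJ).
Qed.

(** The competitors in the infimum are closed under coordinatewise minimum, so a single one comes
    close in all coordinates of [J]. *)
Lemma lowmap_approx {R : realType} {n} (f : ('I_n -> R) -> 'I_n -> R)
    (J : {set 'I_n}) (z B : 'I_n -> R) :
  ophom f -> posvec z -> (forall j, j \in J -> lowmap f J z j < B j) ->
  exists y, [/\ posvec y, forall k, k \in J -> z k <= y k
    & forall j, j \in J -> f y j <= B j].
Proof.
move=> [fp fm _] z0 zB.
have [|x y [x0 zx] [y0 zy]|j x y [x0 _] [y0 _] yx fx jJ|j|y [[y0 zy] fy]] :=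
  common_witness (I := 'I_n)
    (fun y => posvec y /\ forall k, k \in J -> z k <= y k)
    (fun y x => forall k, y k <= x k) (fun j y => j \in J -> f y j <= B j).
- by exists z.
- exists (fun k => Num.min (x k) (y k)); split; first split.
  + by move=> k; rewrite lt_min x0 y0.
  + by move=> k kJ; rewrite le_min zx // zy.
  + by move=> k; rewrite ge_min lexx.
  + by move=> k; rewrite ge_min lexx orbT.
- by apply: le_trans (fx jJ); apply: fm.
- have [jJ|jJ] := boolP (j \in J); last by exists z.
  have [|_ [y [y0 zy] <-] yB] := inf_lt _ (zB j jJ).
    by exists (f z j), z.
  by exists y; split=> // _; apply: ltW.
- by exists y.
Qed.

Lemma lowmap_hom {R : realType} {n} (f : ('I_n -> R) -> 'I_n -> R)
    (J : {set 'I_n}) (t : R) (z : 'I_n -> R) j :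
  ophom f -> 0 < t -> posvec z ->
  lowmap f J (fun k => t * z k) j = t * lowmap f J z j.
Proof.
move=> fP; have [_ _ fh] := fP.
have le s w : 0 < s -> posvec w ->
    s * lowmap f J w j <= lowmap f J (fun k => s * w k) j.
  move=> s0 w0; apply: lowmap_ge; first exact: posvecZ.
  move=> y y0 wy; rewrite -ler_pdivlMl // -fh ?invr_gt0 //.
  apply: lowmap_le => //; first by apply: posvecZ; rewrite ?invr_gt0.
  by move=> k kJ; rewrite ler_pdivlMl // wy.
move=> t0 z0; apply/le_anti; rewrite le // andbT.
have := le t^-1 _ _ (posvecZ t z t0 z0); rewrite invr_gt0 => /(_ t0).
rewrite ler_pdivrMl //.
have -> // : (fun k => t^-1 * (t * z k)) = z.
by apply/funext => k; rewrite mulKf // lt0r_neq0.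
Qed.

Lemma lowmap_ge0 {R : realType} {n} (f : ('I_n -> R) -> 'I_n -> R)
    (J : {set 'I_n}) (z : 'I_n -> R) j :
  ophom f -> posvec z -> 0 <= lowmap f J z j.
Proof.
by move=> [fp _ _] z0; apply: lowmap_ge => // y y0 _; apply/ltW/fp.
Qed.

(** * Normalisation at an eigenvector and descent to subsets *)

(** These model the eigenvectors of [f0 f J] in the part of [J], with positive filler values off
    [J]. The eigenvalue may vanish, since the boundary extension may. *)
Definition loweig {R : realType} {n} (f : ('I_n -> R) -> 'I_n -> R)
    (J : {set 'I_n}) (mu : R) (u : 'I_n -> R) :=
  [/\ 0 <= mu, posvec u & forall j, j \in J -> lowmap f J u j = mu * u j].

(* [f] restricted to [J] and conjugated so that the eigenvector [u] becomes
   the fixed point [1]; the value off [J] is the identity only to keep a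
   self-map of the positive cone. *)
Definition normmap {R : realType} {n} (f : ('I_n -> R) -> 'I_n -> R)
    (J : {set 'I_n}) (mu : R) (u z : 'I_n -> R) (j : 'I_n) : R :=
  if j \in J then lowmap f J (fun k => u k * z k) j / (mu * u j) else z j.

Lemma normmap1 {R : realType} {n} (f : ('I_n -> R) -> 'I_n -> R)
    (J : {set 'I_n}) (mu : R) (u : 'I_n -> R) j :
  0 < mu -> loweig f J mu u -> normmap f J mu u (fun=> 1) j = 1.
Proof.
move=> mu0 [_ u0 fu]; rewrite /normmap; case: ifP => // jJ.
have -> : (fun k => u k * 1) = u by apply/funext => k; rewrite mulr1.
by rewrite fu // mulfV // lt0r_neq0 // mulr_gt0.
Qed.

Lemma normmap_ophom {R : realType} {n} (f : ('I_n -> R) -> 'I_n -> R)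
    (J : {set 'I_n}) (mu : R) (u : 'I_n -> R) :
  ophom f -> 0 < mu -> loweig f J mu u -> ophom (normmap f J mu u).
Proof.
move=> fP mu0 fu; have [_ u0 _] := fu.
have muu j : 0 < mu * u j by rewrite mulr_gt0.
have gm x y : posvec x -> posvec y -> (forall i, x i <= y i) ->
    forall i, normmap f J mu u x i <= normmap f J mu u y i.
  move=> x0 y0 xy i; rewrite /normmap; case: ifP => // iJ.
  rewrite ler_pM2r ?invr_gt0 //; apply: lowmap_mono => //.
    exact: posvecM.
  by move=> k _; rewrite ler_pM2l.
have gh t x : 0 < t -> posvec x -> forall i,
    normmap f J mu u (fun j => t * x j) i = t * normmap f J mu u x i.
  move=> t0 x0 i; rewrite /normmap; case: ifP => // iJ.
  have -> : (fun k => u k * (t * x k)) = (fun k => t * (u k * x k)).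
    by apply/funext => k; rewrite mulrCA.
  by rewrite lowmap_hom // ?mulrA //; apply: posvecM.
split=> // x x0 i.
(* Positivity comes from the fixed vector: [x] dominates [m] times the vector [1], hence so does its
   image. *)
have [m [m0 mx]] := pos_lower_bound x x0.
apply: lt_le_trans (gm (fun j => m * 1) x _ x0 _ i).
- by rewrite gh // normmap1 // mulr1.
- by move=> j; rewrite mulr1.
- by move=> j; rewrite mulr1.
Qed.

Lemma gap_subset {R : realType} {n} (f : ('I_n -> R) -> 'I_n -> R)
    (I J : {set 'I_n}) (mu C : R) (u : 'I_n -> R) :
  ophom f -> gap f J -> loweig f J mu u ->
  (forall v, loweig f J mu v -> forall i k, i \in J -> k \in J ->
     v i * u k <= C * (u i * v k)) ->
  I != finset.set0 -> I \subset J -> gap f I.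
Proof.
move=> fP gJ fu bd I0 IJ; have [mu_ge0 u0 fuE] := fu.
have [fp fm fh] := fP.
have [<-//|IneJ] := eqVneq J I.
have [k kJ kI] : exists2 k, k \in J & k \notin I.
  by apply/fintype.subsetPn; apply: contra IneJ => JI; rewrite finset.eqEsubset JI.
have [i iI] := finset.set0Pn _ I0; have iJ := fintype.subsetP IJ i iI.
have uu0 : 0 < u i * u k by rewrite mulr_gt0.
have C0 : 1 <= C by have := bd u fu i k iJ kJ; rewrite ler_pMl.
(* If [mu = 0], the extension vanishes on [J] at every positive vector, so all of them are
   eigenvectors; stretching coordinate [i] of [u] by [C + 1] breaks the bound. *)
have [mu0|mu0] := leP mu 0.
  have {}mu0 : mu = 0 by apply/le_anti/andP.
  pose v j := if j == i then (C + 1) * u i else u j.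
  have v0 : posvec v.
    by move=> j; rewrite /v; case: ifP => // _; rewrite mulr_gt0 //; lra.
  have fv : loweig f J mu v.
    split=> // j jJ; rewrite mu0 mul0r; apply/le_anti.
    rewrite lowmap_ge0 // andbT.
    have -> : 0 = lowmap f J (fun l => (C + 1) * u l) j.
      by rewrite lowmap_hom // ?fuE // ?mu0; [ring|lra].
    apply: lowmap_mono => //; first by apply: posvecZ => //; lra.
    move=> l _; rewrite /v; case: eqP => [->//|_].
    by rewrite ler_peMl ?(ltW (u0 _)) //; lra.
  have := bd v fv i k iJ kJ.
  rewrite /v eqxx; case: eqP => [ki|_]; first by rewrite ki iI in kI.
  by rewrite -mulrA ler_pM2r //; lra.
apply: contrapT => nogap.
pose g := normmap f J mu u.
have gP : ophom g by apply: normmap_ophom.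
have [gp _ _] := gP.
have g1 j : g (fun=> 1) j = 1 by apply: normmap1.
have muu j : 0 < mu * u j by rewrite mulr_gt0.
have gE z j : j \in J -> lowmap f J (fun l => u l * z l) j = mu * u j * g z j.
  by move=> jJ; rewrite /g /normmap jJ mulrC mulfVK // lt0r_neq0.
have approx z c : posvec z -> 1 < c -> exists y, [/\ posvec y,
    forall l, l \in J -> u l * z l <= y l
  & forall j, j \in J -> f y j <= c * (mu * u j * g z j)].
  move=> z0 c1; apply: lowmap_approx => //; first exact: posvecM.
  move=> j jJ; rewrite gE // ltr_pMl // mulr_gt0 //; exact: gp.
(* A spread of [C + 1] exceeds the bound [C]. In each of the two non-gap hypotheses, a
   counterexample would produce the gap at [I]. *)
have [|a x a1 x0 gx|b y b1 y0 gy||z [z0 gz [i' [k' [i'I k'K zi zk]]]]] :=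
    spread_fixed_point g I (J :\: I) (C + 1) gP g1.
- by rewrite -finset.setI_eq0; apply/eqP/finset.setP => j; rewrite !inE; case: (j \in I); rewrite ?andbF.
- have a0 : 0 < a.
    by have := gx i iI; have := gp x x0 i => ? /(lt_le_trans _) h;
       rewrite -(pmulr_lgt0 _ (x0 i)); apply: h.
  (* This error factor for the infimum leaves the rate [a * (1 + a^-1) / 2 = (1 + a) / 2], still
     below [1]. The lower vector is [u] itself, at rate [mu]. *)
  have c1 : 1 < (1 + a^-1) / 2 by have : 1 < a^-1 by [rewrite invf_gt1]; lra.
  have [y [y0 xy fy]] := approx x _ x0 c1.
  apply: nogap.
  apply: (gap_extend f I J (mu * ((1 + a) / 2)) mu y u) => //.
  + by rewrite mulr_gt0 //; lra.
  + by rewrite gtr_pMr //; lra.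
  + move=> l lI; have lJ := fintype.subsetP IJ l lI; apply: le_trans (fy l lJ) _.
    apply: (@le_trans _ _ (mu * ((1 + a) / 2) * (u l * x l))); last first.
      by rewrite ler_pM2l ?xy // mulr_gt0 //; lra.
    have -> : mu * ((1 + a) / 2) * (u l * x l) =
        (1 + a^-1) / 2 * (mu * u l * (a * x l)) by field; lra.
    by rewrite ler_pM2l ?ler_pM2l ?gx //; lra.
  + by move=> w w0 uw j jJ _; rewrite -fuE //; apply: lowmap_le.
(* Here the upper vector approximates [u] at a rate between [mu] and [mu * b], and [u * y] is the
   lower vector. *)
- have c1 : 1 < (1 + b) / 2 by lra.
  have [x [x0 ux fx]] := approx (fun=> 1) _ (fun _ => ltr01) c1.
  apply: nogap.
  apply: (gap_extend f I J (mu * ((1 + b) / 2)) (mu * b) x (fun l => u l * y l)) => //.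
  + by rewrite mulr_gt0 //; lra.
  + by rewrite ltr_pM2l //; lra.
  + exact: posvecM.
  + move=> l lI; have lJ := fintype.subsetP IJ l lI; apply: le_trans (fx l lJ) _.
    rewrite g1 mulr1 mulrCA mulrA ler_pM2l; last by rewrite mulr_gt0 //; lra.
    by have := ux l lJ; rewrite mulr1.
  + move=> w w0 uyw j jJ jI; apply: le_trans (lowmap_le _ _ _ _ j fP w0 uyw).
    rewrite gE //.
    have -> : mu * b * (u j * y j) = mu * u j * (b * y j) by ring.
    by rewrite ler_pM2l // gy // inE jI.
- by lra.
- have uz0 := posvecM _ _ u0 z0.
  have i'J := fintype.subsetP IJ _ i'I.
  have k'J : k' \in J by move: k'K; rewrite inE => /andP[].
  have fuz : loweig f J mu (fun l => u l * z l).
    by split=> // j jJ; rewrite gE // gz mulrA.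
  have := bd _ fuz i' k' i'J k'J.
  have -> : u i' * z i' * u k' = u i' * u k' * z i' by ring.
  have -> : C * (u i' * (u k' * z k')) = u i' * u k' * (C * z k') by ring.
  have C00 : 0 < C by lra.
  rewrite ler_pM2l ?mulr_gt0 // zi => h.
  by move: zk; rewrite -(ler_pM2l C00); lra.
Qed.

(** * The two continuous extensions expressed by [lowmap] *)

(* [Pj 0 J] and [Pj +oo K] see only the finite part of a vector of [part0 J]
   or [partinf K]; [trunc] records it as a positive real vector. *)
Definition trunc {R : realType} {n} (J : {set 'I_n}) (x : evec R n)
    (j : 'I_n) : R :=
  if j \in J then fine (x j) else 1.

Lemma Pj_trunc {R : realType} {n} (a : \bar R) (J : {set 'I_n}) (x : evec R n) :
  (forall j, j \in J -> (0 < x j < +oo)%E) ->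
  Pj a J x = Pj a J (fun j => (trunc J x j)%:E).
Proof.
move=> xJ; apply/funext => j; rewrite /Pj /trunc; case: ifP => // jJ.
by rewrite fineK // gt0_fin_numE; have /andP[] := xJ j jJ.
Qed.

Lemma trunc_pos {R : realType} {n} (J : {set 'I_n}) (x : evec R n) :
  (forall j, j \in J -> (0 < x j < +oo)%E) -> posvec (trunc J x).
Proof.
by move=> xJ j; rewrite /trunc; case: ifP => // jJ; apply/fine_gt0/xJ.
Qed.

Lemma ext0_le {R : realType} {n} (f : ('I_n -> R) -> 'I_n -> R)
    (J : {set 'I_n}) (u y : 'I_n -> R) j :
  ophom f -> posvec u -> posvec y -> (forall k, k \in J -> u k <= y k) ->
  (ext0 f (Pj 0%E J (fun k => (u k)%:E)) j <= (f y j)%:E)%E.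
Proof.
move=> fP u0 y0 uy; have [fp _ _] := fP.
apply/lee_addgt0Pr => e e0.
have fy0 : 0 < f y j by apply: fp.
have [m [m0 my]] := pos_lower_bound y y0.
(* With this [c], [(1 + c) * f y j = f y j + e]; the perturbation [c * m] is small enough for the
   perturbed vector to stay below [(1 + c) * y]. *)
pose c := e / f y j.
have c0 : 0 < c by rewrite divr_gt0.
apply: ge_ereal_inf.
eexists; first by exists (c * m) => //=; rewrite mulr_gt0.
rewrite -EFinD lee_fin.
have -> : f y j + e = (1 + c) * f y j by rewrite /c; field; rewrite lt0r_neq0.
apply: ophom_le_scale => //; first lra.
- move=> k; rewrite /Pj; case: ifP => _ /=; last by rewrite add0r mulr_gt0.
  by apply: addr_gt0 => //; apply: mulr_gt0.
- move=> k; rewrite mulrDl mul1r; apply: lerD; last by rewrite ler_pM2l.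
  by rewrite /Pj; case: ifP => [/uy//|_] /=; apply/ltW.
Qed.

Lemma ext0_lowmap {R : realType} {n} (f : ('I_n -> R) -> 'I_n -> R)
    (J : {set 'I_n}) (u : 'I_n -> R) j :
  ophom f -> posvec u ->
  ext0 f (Pj 0%E J (fun k => (u k)%:E)) j = (lowmap f J u j)%:E.
Proof.
move=> fP u0; apply/le_anti/andP; split.
  apply/lee_addgt0Pr => e e0.
  have ne : ([set f y j | y in [set y | posvec y /\
      forall k, k \in J -> u k <= y k]] !=set0)%classic by exists (f u j), u.
  have [_ [y [y0 uy] <-] yE] := inf_lt ne (ltr_pwDr e0 (lexx _)).
  apply: le_trans (ext0_le _ _ _ _ j fP u0 y0 uy) _.
  by rewrite -EFinD lee_fin ltW.
apply: le_ereal_inf_tmp => _ [e /= e0 <-]; rewrite lee_fin.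
apply: lowmap_le => // k => [|kJ]; rewrite /Pj.
  by case: ifP => _ /=; rewrite ?add0r // addr_gt0.
by rewrite kJ /= lerDl ltW.
Qed.

Lemma extinf_ge {R : realType} {n} (f : ('I_n -> R) -> 'I_n -> R)
    (K : {set 'I_n}) (u y : 'I_n -> R) j :
  ophom f -> posvec u -> posvec y -> (forall k, k \in K -> y k <= u k) ->
  ((f y j)%:E <= extinf f (Pj +oo%E K (fun k => (u k)%:E)) j)%E.
Proof.
move=> [fp fm _] u0 y0 yu; have [t [t0 yt]] := pos_upper_bound y.
apply: le_ereal_sup_tmp.
eexists; first by exists t.
rewrite lee_fin; apply: fm => // k; rewrite /Pj; case: ifP => [kK|_] /=.
- by rewrite -EFin_min /= lt_min u0.
- by [].
- by rewrite -EFin_min /= le_min yu // yt.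
- by [].
Qed.

Lemma extinf_le {R : realType} {n} (f : ('I_n -> R) -> 'I_n -> R)
    (K : {set 'I_n}) (u : 'I_n -> R) (v : R) j :
  posvec u ->
  (forall y, posvec y -> (forall k, k \in K -> y k <= u k) -> f y j <= v) ->
  (extinf f (Pj +oo%E K (fun k => (u k)%:E)) j <= v%:E)%E.
Proof.
move=> u0 fv; apply: ge_ereal_sup => _ [t /= t0 <-]; rewrite lee_fin.
apply: fv => k => [|kK]; rewrite /Pj.
  case: ifP => _; first by rewrite -EFin_min /= lt_min u0.
  by [].
by rewrite kK -EFin_min /= ge_min lexx.
Qed.

(** Inversion turns the supremum of [f] below [u] into the infimum of the dual above the inverse of
    [u]. Positivity of [L] says that this supremum is finite. *)
Lemma extinf_lowmap {R : realType} {n} (f : ('I_n -> R) -> 'I_n -> R)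
    (K : {set 'I_n}) (u : 'I_n -> R) j :
  let L := lowmap (dualf f) K (fun k => (u k)^-1) j in
  ophom f -> posvec u -> 0 < L ->
  extinf f (Pj +oo%E K (fun k => (u k)%:E)) j = (L^-1)%:E.
Proof.
move=> L fP u0 L0; have [fp _ _] := fP; have dP := dualf_ophom f fP.
have le : (extinf f (Pj +oo%E K (fun k => (u k)%:E)) j <= (L^-1)%:E)%E.
  apply: extinf_le => // y y0 yu.
  have fy0 : 0 < f y j by apply: fp.
  rewrite -[leLHS]invrK lef_pV2 ?posrE ?invr_gt0 //.
  have -> : (f y j)^-1 = dualf f (fun k => (y k)^-1) j.
    by congr (f _ j)^-1; apply/funext => k; rewrite invrK.
  apply: lowmap_le => //; first exact: posvecV.
  by move=> k kK; rewrite lef_pV2 ?posrE // yu.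
apply/le_anti; rewrite le /=.
move: le (extinf_ge f K u u j fP u0 u0 (fun k _ => lexx _)).
have fle y : posvec y -> (forall k, k \in K -> y k <= u k) ->
   ((f y j)%:E <= extinf f (Pj +oo K (fun k => (u k)%:E)) j)%E.
  exact: extinf_ge.
case: extinf fle => [s|//|//] fle _; rewrite !lee_fin => fs.
have fu0 : 0 < f u j by apply: fp.
have s0 := lt_le_trans fu0 fs.
rewrite -[leRHS]invrK lef_pV2 ?posrE ?invr_gt0 //.
apply: lowmap_ge => [|y y0 uy]; first exact: posvecV.
rewrite /dualf lef_pV2 ?posrE ?fp //; last exact: posvecV.
rewrite -lee_fin; apply: fle => [|k kK]; first exact: posvecV.
by rewrite -[leRHS]invrK lef_pV2 ?posrE ?invr_gt0 // uy.
Qed.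

Lemma lt_extinf_lowmap {R : realType} {n} (f : ('I_n -> R) -> 'I_n -> R)
    (K : {set 'I_n}) (u : 'I_n -> R) (c : R) j :
  ophom f -> posvec u -> 0 < c ->
  (c%:E < extinf f (Pj +oo%E K (fun k => (u k)%:E)) j)%E ->
  lowmap (dualf f) K (fun k => (u k)^-1) j < c^-1.
Proof.
move=> fP u0 c0 cf; have [L0|] := ltP 0 (lowmap (dualf f) K (fun k => (u k)^-1) j).
  move: cf; rewrite extinf_lowmap // lte_fin => cL.
  by rewrite -[ltLHS]invrK ltf_pV2 ?posrE ?invr_gt0.
by move=> /le_lt_trans; apply; rewrite invr_gt0.
Qed.

(** * The spectral inequality as a gap *)

Lemma ereal_between {R : realType} (p q : \bar R) :
  (0 <= p)%E -> (p < q)%E ->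
  exists a b : R, [/\ 0 < a, a < b, (p < a%:E)%E & (b%:E < q)%E].
Proof.
case: p q => [p| |] [q| |] //; rewrite ?lee_fin ?lte_fin => p0 pq.
- exists ((2 * p + q) / 3), ((p + 2 * q) / 3); rewrite !lte_fin; split; lra.
- by exists (p + 1), (p + 2); rewrite !lte_fin ltry; split=> //; lra.
Qed.

(** Near-optimal vectors for [rspec] and [lspec] leave room for [a < b]. The strict inequalities
    allow the boundary values to be replaced by values of [f] at positive vectors, [z] above [x] on
    [I] and the inverse of [w] below [y] off [I]. *)
Lemma gap_of_lt {R : realType} {n} (f : ('I_n -> R) -> 'I_n -> R)
    (I : {set 'I_n}) : ophom f -> I != finset.set0 ->
  (rspec (f0 f I) < lspec (finf f (~: I)))%E -> gap f I.
Proof.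
move=> fP I0 /ereal_inf_lt[_ [x x0 <-]] /ereal_sup_gt[_ [y y0 <-]] xy.
have [i iI] := finset.set0Pn _ I0.
have dP := dualf_ophom f fP.
have [|a [b [a0 ab xa by_]]] := ereal_between _ _ _ xy.
  apply: (bigmax_sup i) => //.
  rewrite /f0 {1}/Pj iI ext0_lowmap // -EFinM lee_fin.
  by rewrite divr_ge0 ?lowmap_ge0 // ltW.
have b0 := lt_trans a0 ab.
have [|z [z0 xz fz]] := lowmap_approx f I x (fun j => a * x j) fP x0.
  move=> j jI; rewrite -ltr_pdivrMr //.
  rewrite -lte_fin; apply: le_lt_trans xa.
  apply: (bigmax_sup j) => //.
  by rewrite /f0 [X in (_ <= X * _)%E]/Pj jI ext0_lowmap // -EFinM.
have [||w [w0 yw fw]] := lowmap_approx (dualf f) (~: I) (fun j => (y j)^-1)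
    (fun j => (b * y j)^-1) dP.
- exact: posvecV.
- move=> j jI; apply: lt_extinf_lowmap => //; first by rewrite mulr_gt0.
  rewrite EFinM -lte_pdivlMr //; apply: lt_le_trans by_ _.
  apply: (bigmin_inf j) => //.
  by rewrite /finf [X in (X * _ <= _)%E]/Pj jI.
exists a, b, z, (fun j => (w j)^-1); split; first by rewrite a0.
- by split=> //; apply: posvecV.
- move=> j jI; apply: le_trans (fz j jI) _.
  by rewrite ler_pM2l // xz.
- move=> j; rewrite -finset.in_setC => jI.
  have := fw j jI; rewrite /dualf lef_pV2 ?posrE ?mulr_gt0 //; last first.
    by have [fp _ _] := fP; apply/fp/posvecV.
  apply: le_trans; rewrite ler_pM2l // -[leRHS]invrK.
  by rewrite lef_pV2 ?posrE ?invr_gt0 // yw.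
Qed.

Lemma lt_of_gap {R : realType} {n} (f : ('I_n -> R) -> 'I_n -> R)
    (I : {set 'I_n}) : ophom f ->
  gap f I -> (rspec (f0 f I) < lspec (finf f (~: I)))%E.
Proof.
move=> fP [a [b [x [y [/andP[a0 ab] [x0 y0] fx fy]]]]].
(* The coordinates filled in by [Pj] are harmless: [0] in a maximum bounded by [a], [+oo] in a
   minimum bounded below by [b]. *)
apply: (@le_lt_trans _ _ a%:E).
  apply: ge_ereal_inf; eexists; first by exists x.
  apply: bigmax_le => [|i _]; first exact: leNye.
  rewrite lee_pdivrMr // -EFinM /f0 [X in (X <= _)%E]/Pj; case: ifP => iI.
    rewrite ext0_lowmap // lee_fin; apply: le_trans (fx i iI).
    exact: lowmap_le.
  by rewrite lee_fin mulr_ge0 // ltW.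
apply: (@lt_le_trans _ _ b%:E); first by rewrite lte_fin.
apply: le_ereal_sup_tmp; eexists; first by exists y.
apply: le_bigmin => [|i _]; first exact: leey.
rewrite lee_pdivlMr // -EFinM /finf [X in (_ <= X)%E]/Pj; case: ifP => iI.
  apply: le_trans (extinf_ge _ _ y y i fP y0 y0 (fun _ _ => lexx _)).
  by rewrite lee_fin fy // -finset.in_setC.
exact: leey.
Qed.

(** * Eigenvectors and Hilbert's metric *)

Lemma le_expR_dH {R : realType} {n} (C : R) (x y : evec R n) i j :
  (0 < x i < +oo)%E -> (0 < x j < +oo)%E ->
  (0 < y i < +oo)%E -> (0 < y j < +oo)%E -> dH x y <= C ->
  fine (y i) * fine (x j) <= sequences.expR C * (fine (x i) * fine (y j)).
Proof.
move=> xi xj yi yj xyC.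
rewrite -ler_pdivrMr ?mulr_gt0 ?fine_gt0 //.
rewrite -[leLHS]lnK ?posrE ?divr_gt0 ?mulr_gt0 ?fine_gt0 //.
rewrite ler_expR; apply: le_trans xyC.
by apply: (bigmax_sup i) => //; apply: (bigmax_sup j).
Qed.

Lemma PjK {R : realType} {n} (a : \bar R) (J : {set 'I_n}) (x : evec R n) :
  Pj a J (Pj a J x) = Pj a J x.
Proof. by apply/funext => j; rewrite /Pj; case: (j \in J). Qed.

Lemma EFin_pos {R : realType} {n} (v : 'I_n -> R) j :
  posvec v -> (0 < (v j)%:E < +oo)%E.
Proof. by move=> v0; rewrite lte_fin ltry andbT; apply: v0. Qed.

Lemma eigvec0_loweig {R : realType} {n} (f : ('I_n -> R) -> 'I_n -> R)
    (J : {set 'I_n}) (x : evec R n) :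
  ophom f -> J != finset.set0 -> eigvec_in (f0 f J) (part0 J) x ->
  exists mu, loweig f J mu (trunc J x).
Proof.
move=> fP J0 [xJ [mu fx]].
have xpos j : j \in J -> (0 < x j < +oo)%E by have [] := xJ j.
have u0 := trunc_pos J x xpos.
have fu j : j \in J -> lowmap f J (trunc J x) j = mu * trunc J x j.
  move=> jJ; have := congr1 (fun g => g j) fx.
  rewrite /f0 (Pj_trunc _ _ _ xpos) [LHS]/Pj jJ ext0_lowmap // => h.
  apply: EFin_inj; rewrite h EFinM /trunc jJ fineK // gt0_fin_numE.
    by have /andP[] := xpos j jJ.
  by have /andP[] := xpos j jJ.
exists mu; split=> //; have [j jJ] := finset.set0Pn _ J0.
by rewrite -(pmulr_lge0 _ (u0 j)) -fu // lowmap_ge0.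
Qed.

Lemma loweig_eigvec0 {R : realType} {n} (f : ('I_n -> R) -> 'I_n -> R)
    (J : {set 'I_n}) (mu : R) (v : 'I_n -> R) :
  ophom f -> loweig f J mu v ->
  eigvec_in (f0 f J) (part0 J) (Pj 0%E J (fun j => (v j)%:E)).
Proof.
move=> fP [mu0 v0 fv]; split.
  by move=> j; rewrite /Pj; case: ifP => // jJ; split=> // _; exact: (EFin_pos v j).
exists mu; apply/funext => j; rewrite /f0 PjK [LHS]/Pj [in RHS]/Pj.
by case: ifP => jJ; rewrite ?mule0 // ext0_lowmap // fv // EFinM.
Qed.

Lemma eigvecinf_loweig {R : realType} {n} (f : ('I_n -> R) -> 'I_n -> R)
    (K : {set 'I_n}) (x : evec R n) :
  ophom f -> K != finset.setT -> eigvec_in (finf f K) (partinf K) x ->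
  exists2 mu, 0 < mu & loweig (dualf f) K mu (fun j => (trunc K x j)^-1).
Proof.
move=> fP KT [xK [mu fx]].
have xpos j : j \in K -> (0 < x j < +oo)%E by have [] := xK j.
have u0 := trunc_pos K x xpos.
(* A coordinate off [K] reads [+oo = mu * +oo], which excludes [mu <= 0]. *)
have mu0 : 0 < mu.
  have [j jK] : exists j, j \notin K.
    have /finset.set0Pn[j] : ~: K != finset.set0.
      by apply: contra_neq KT => K0; rewrite -(finset.setCK K) K0 finset.setC0.
    by rewrite inE => jK; exists j.
  have [_ /(_ jK) xj] := xK j.
  have := congr1 (fun g => g j) fx.
  rewrite /finf [LHS]/Pj (negbTE jK) xj.
  case: (ltgtP mu 0) => [mu0|//|->]; last by rewrite mul0e.
  by rewrite lt0_muley ?lte_fin.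
exists mu^-1; first by rewrite invr_gt0.
split; [by rewrite invr_ge0 ltW|exact: posvecV|move=> j jK].
have fxj : extinf f (Pj +oo%E K (fun k => (trunc K x k)%:E)) j =
    (mu * trunc K x j)%:E.
  have := congr1 (fun g => g j) fx.
  rewrite /finf (Pj_trunc _ _ _ xpos) [LHS]/Pj jK => ->.
  by rewrite EFinM /trunc jK fineK // gt0_fin_numE; have /andP[] := xpos j jK.
have muu : 0 < mu * trunc K x j by rewrite mulr_gt0.
(* The eigenvalue equation makes the extension finite at [j], which bounds the dual infimum away
   from zero. *)
have L0 : 0 < lowmap (dualf f) K (fun k => (trunc K x k)^-1) j.
  apply: (@lt_le_trans _ _ (mu * trunc K x j)^-1); first by rewrite invr_gt0.
  apply: lowmap_ge => [|y y0 uy]; first exact: posvecV.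
  rewrite lef_pV2 ?posrE //; last by have [fp _ _] := fP; apply/fp/posvecV.
  rewrite -lee_fin -fxj; apply: extinf_ge => //; first exact: posvecV.
  by move=> k kK; rewrite -[leRHS]invrK lef_pV2 ?posrE ?invr_gt0 // uy.
have [h] := etrans (esym (extinf_lowmap f K _ j fP u0 L0)) fxj.
by rewrite -[LHS]invrK h invfM.
Qed.

Lemma loweig_eigvecinf {R : realType} {n} (f : ('I_n -> R) -> 'I_n -> R)
    (K : {set 'I_n}) (mu : R) (v : 'I_n -> R) :
  ophom f -> 0 < mu -> loweig (dualf f) K mu v ->
  eigvec_in (finf f K) (partinf K) (Pj +oo%E K (fun j => ((v j)^-1)%:E)).
Proof.
move=> fP mu0 [_ v0 fv]; have v'0 := posvecV v v0; split.
  by move=> j; rewrite /Pj; case: ifP => // jJ; split=> // _; exact: (EFin_pos _ j v'0).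
exists mu^-1; apply/funext => j; rewrite /finf PjK [LHS]/Pj [in RHS]/Pj.
case: ifP => jK; last by rewrite gt0_muley // lte_fin invr_gt0.
have -> : (mu^-1%:E * (v j)^-1%:E)%E = (mu * v j)^-1%:E :> \bar R.
  by rewrite -EFinM invfM.
have E : lowmap (dualf f) K (fun k => (v k)^-1^-1) j = mu * v j.
  rewrite -fv //; congr lowmap; apply/funext => k; exact: invrK.
by rewrite extinf_lowmap ?E // mulr_gt0.
Qed.

Theorem theorem3p4 (R : realType) (n : nat) (f : ('I_n -> R) -> ('I_n -> R))
  (f_pos : forall x, posvec x -> posvec (f x))
  (f_mono : forall x y, posvec x -> posvec y -> (forall i, x i <= y i) ->
      forall i, f x i <= f y i)
  (f_hom : forall (t : R) x, 0 < t -> posvec x ->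
      f (fun i => t * x i) = (fun i => t * f x i))
  (J : {set 'I_n}) (J0 : J != finset.set0) (JT : J != finset.setT)
  (hJ : (rspec (f0 f J) < lspec (finf f (~: J)))%E) :
  ((exists x, eigvec_in (f0 f J) (part0 J) x) ->
    dH_bounded (eigvec_in (f0 f J) (part0 J)) ->
    forall I : {set 'I_n}, I != finset.set0 -> I \subset J ->
      (rspec (f0 f I) < lspec (finf f (~: I)))%E)
  /\
  ((exists x, eigvec_in (finf f (~: J)) (partinf (~: J)) x) ->
    dH_bounded (eigvec_in (finf f (~: J)) (partinf (~: J))) ->
    forall I : {set 'I_n}, J \subset I -> I != finset.setT ->
      (rspec (f0 f I) < lspec (finf f (~: I)))%E).
Proof.
have fP : ophom f by split=> // t x t0 x0 i; rewrite f_hom.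
have gJ := gap_of_lt f J fP J0 hJ.
split=> [[x fx] [C bd] I I0 IJ|[x fx] [C bd] I JI IT]; apply: lt_of_gap => //.
- have [mu fu] := eigvec0_loweig f J x fP J0 fx; have [_ u0 _] := fu.
  apply: (gap_subset f I J mu (sequences.expR C) (trunc J x)) => // v fv i k iJ kJ.
  have [_ v0 _] := fv.
  have := bd _ _ (loweig_eigvec0 f J mu _ fP fu) (loweig_eigvec0 f J mu _ fP fv).
  by move/(le_expR_dH C _ _ i k); rewrite /Pj iJ kJ /= => h; apply: h; apply: EFin_pos.
- have KT : ~: J != finset.setT.
    by apply: contra_neq J0 => K0; rewrite -(finset.setCK J) K0 finset.setCT.
  have [mu mu0 fu] := eigvecinf_loweig f (~: J) x fP KT fx; have [_ u0 _] := fu.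
  have dP := dualf_ophom f fP.
  (* The second half is the first for the dual map, with [~: I] inside [~: J]. *)
  rewrite -(dualfK f) -(finset.setCK I); apply: gap_dualf => //.
  apply: (gap_subset (dualf f) (~: I) (~: J) mu (sequences.expR C) _ dP _ fu).
  + exact: gap_dualf.
  + move=> v fv i k iK kK; have [_ v0 _] := fv.
    have v'0 := posvecV v v0.
    have t0 : posvec (trunc (~: J) x) by move=> j; rewrite -invr_gt0; apply: u0.
    have := bd _ _ (loweig_eigvecinf f _ mu _ fP mu0 fu)
                   (loweig_eigvecinf f _ mu _ fP mu0 fv).
    (* Inverting vectors inverts their ratios, so the bound is taken with [i] and [k] exchanged and
       then multiplied by the positive factor of [w0]. *)
    move/(le_expR_dH C _ _ k i); rewrite /Pj iK kK /= !invrK => h.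
    have {h} := h (EFin_pos _ k t0) (EFin_pos _ i t0) (EFin_pos _ k v'0)
      (EFin_pos _ i v'0).
    set t := trunc (~: J) x in t0 *; move=> h.
    have w0 : 0 < v k * v i / (t i * t k) by rewrite divr_gt0 ?mulr_gt0.
    rewrite -(ler_pM2l w0) in h.
    have nz j : t j != 0 /\ v j != 0 by rewrite !lt0r_neq0.
    have [[ti vi] [tk vk]] := (nz i, nz k).
    have -> : v i * (t k)^-1 = v k * v i / (t i * t k) * ((v k)^-1 * t i).
      by field; rewrite ti tk vk.
    apply: le_trans h _; rewrite le_eqVlt; apply/orP; left; apply/eqP.
    by field; rewrite ti tk vi.
  + by apply: contra_neq IT => K0; rewrite -(finset.setCK I) K0 finset.setC0.
  + by rewrite finset.setCS.
Qed.
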